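(* Let $\mathbf{f}_1(t),\dots,\mathbf{f}_n(t)\in\mathbb{Z}[t]^m$ and, for $t\in\mathbb{N}$, let $\Lambda_t=\operatorname{Span}_{\mathbb{Z}}\{\mathbf{f}_1(t),\dots,\mathbf{f}_n(t)\}\subseteq\mathbb{Z}^m$. Then there exist $N\in\mathbb{N}$ and $\mathbf{g}_0,\dots,\mathbf{g}_{N-1}\in\mathbb{Q}[t]^m$ such that for all sufficiently large $t\in\mathbb{N}$, the vector $$\mathbf{u}(t)=\mathbf{g}_i(t)\quad\text{if } t\equiv i \pmod N$$ is a shortest nonzero vector (in the Euclidean norm) of $\Lambda_t$.
   Context: Lengths are Euclidean: $\|\mathbf{x}\|^2=\sum_k x_k^2$.
   Formalization: It is additionally assumed that at least one f_j is not the zero vector of polynomials; if all f_j are zero, then Λ_t = {0} for every t and no shortest nonzero vector exists. *)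

(* Defs.v *)
From mathcomp Require Import all_boot all_order all_algebra.
From mathcomp Require Import reals.

Set Implicit Arguments.
Unset Strict Implicit.
Unset Printing Implicit Defensive.

Import Order.TTheory GRing.Theory Num.Theory.

Local Open Scope ring_scope.

Definition poly_vec_eval (A : nzRingType) (m : nat) (f : 'rV[{poly A}]_m)
    (t : nat) : 'rV[A]_m :=
  \row_(k < m) (f 0 k).[t%:R].

Definition lattice_at (m n : nat) (f : n.-tuple 'rV[{poly int}]_m) (t : nat)
    (v : 'rV[int]_m) : Prop :=
  inIntSpan [tuple poly_vec_eval (tnth f j) t | j < n] v.

Definition euclid_norm (R : realType) (m : nat) (v : 'rV[int]_m) : R :=
  Num.sqrt (\sum_(k < m) (v 0 k)%:~R ^+ 2).

Definition shortest_nonzero (R : realType) (m : nat) (L : 'rV[int]_m -> Prop)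
    (v : 'rV[int]_m) : Prop :=
  [/\ L v, v != 0 &
      forall w, L w -> w != 0 -> euclid_norm R v <= euclid_norm R w].

(* Main.v *)
Require Import Defs.
From mathcomp Require Import all_boot all_order all_algebra.
From mathcomp Require Import reals ring lra zify.

(** View a row of polynomials as a vector that varies with [t], and call the row
    of its coefficients in top degree its leading row.  If the leading rows of
    the nonzero generators are linearly independent over Q, then for large [t] a
    combination with coefficients [x j] has norm at least a constant times
    [|x j| t^(deg j)], for every [j].  So a vector as short as a generator of
    least degree has bounded coefficients, only finitely many polynomial
    vectors compete, and one of them is eventually the shortest.

    If there is an integer relation [c] between the leading rows, elementary row
    operations lower the sum of the degrees.  When two generators of top degree
    occur in [c], a subtractive Euclid step on their coefficients shrinks [c].
    When only the generator [i] does, we add to it [c j / c i] times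
    [(t - r) t^(e - 1)] times the generator [j], for every other [j], where [e]
    is the difference of degrees: this cancels its leading row, and it is an
    integral operation on the class of [r] modulo [c i].  Such splittings into
    residue classes are the source of the period [N]. *)

Set Implicit Arguments.
Unset Strict Implicit.
Unset Printing Implicit Defensive.

Import Order.TTheory GRing.Theory Num.Theory.

Local Open Scope ring_scope.

(** * Properties that hold from some point on *)

Definition eventually (P : nat -> Prop) : Prop :=
  exists T : nat, forall t : nat, (T <= t)%N -> P t.

Lemma eventually_and (P Q : nat -> Prop) :
  eventually P -> eventually Q -> eventually (fun t => P t /\ Q t).
Proof.
move=> [T hP] [U hQ]; exists (maxn T U) => t; rewrite geq_max => /andP[hT hU].
by split; [apply: hP | apply: hQ].
Qed.

Lemma eventually_forall (I : finType) (P : I -> nat -> Prop) :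
  (forall i, eventually (P i)) -> eventually (fun t => forall i, P i t).
Proof.
move=> /fin_all_exists[T hT]; exists (\max_i T i)%N => t ht i.
by apply: hT; apply: leq_trans ht; apply: leq_bigmax.
Qed.

Lemma eventually_imp (P Q : nat -> Prop) :
  (forall t, P t -> Q t) -> eventually P -> eventually Q.
Proof. by move=> h [T hT]; exists T => t /hT/h. Qed.

Lemma eventually_nat (T : nat) : eventually (fun t => T <= t)%N.
Proof. by exists T. Qed.

(** * Polynomials at infinity *)

Section PolyInfinity.
Variable F : archiRealFieldType.

(** For [t >= 1] and [d > 0] the lower terms add up to at most [S t^(d-1)], and [S <= e t] for large
    [t]. The degree of [p] may be less than [d], so that one exponent serves all entries of a
    row. *)
Lemma poly_top_asymp (p : {poly F}) (d : nat) (e : F) :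
  (size p <= d.+1)%N -> 0 < e ->
  eventually (fun t => `|p.[t%:R] - p`_d * t%:R ^+ d| <= e * t%:R ^+ d).
Proof.
move=> sp e0; pose S : F := \sum_(i < d) `|p`_i|.
have S0 : 0 <= S by apply: sumr_ge0.
have Se : 0 <= S / e by rewrite divr_ge0 // ltW.
exists (Num.bound (S / e)).+1 => t ht.
have t1 : 1 <= t%:R :> F by rewrite (ler_nat _ 1); apply: leq_trans ht.
have St : S <= e * t%:R.
  rewrite mulrC -ler_pdivrMr //; apply: le_trans (ltW (archi_boundP Se)) _.
  by rewrite ler_nat; apply: ltnW.
rewrite (horner_coef_wide _ sp) big_ord_recr /= addrK.
apply: le_trans (ler_norm_sum _ _ _) _.
case: d sp @S S0 Se St ht => [|d] sp S S0 Se St ht.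
  by rewrite big_ord0 expr0 mulr1 ltW.
have td : 0 <= t%:R ^+ d :> F by rewrite exprn_ge0 ?ler0n.
apply: (@le_trans _ _ (S * t%:R ^+ d)).
  rewrite /S mulr_suml; apply: ler_sum => i _.
  rewrite normrM normrX (ger0_norm (ler0n _ t)).
  by apply: ler_wpM2l => //; apply: ler_weXn2l => //; rewrite -ltnS.
by rewrite exprS mulrA ler_wpM2r.
Qed.

Lemma poly_eventually_sign (p : {poly F}) :
  p != 0 -> eventually (fun t => 0 < lead_coef p * p.[t%:R]).
Proof.
move=> p0; have l0 : lead_coef p != 0 by rewrite lead_coef_eq0.
have sp : (size p <= (size p).-1.+1)%N by rewrite leqSpred.
(* An error of at most half the leading term cannot change its sign. *)
have e0 : 0 < `|lead_coef p| / 2 by rewrite divr_gt0 // normr_gt0.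
have := eventually_and (eventually_nat 1) (poly_top_asymp sp e0).
apply: eventually_imp => t []; rewrite -lead_coefE.
set l := lead_coef p in l0 e0 *; set y := p.[_] => t1.
have : 0 < t%:R ^+ (size p).-1 :> F by rewrite exprn_gt0 // ltr0n.
move: (_ ^+ _) => X X0; rewrite ler_norml => /andP[h1 h2].
have [lp|ln|l00] := ltrgt0P l; last by rewrite l00 eqxx in l0.
  rewrite gtr0_norm // in h1; rewrite pmulr_rgt0 //.
  have : 0 < l * X by rewrite mulr_gt0.
  lra.
rewrite ltr0_norm // in h2; rewrite nmulr_rgt0 //.
have : l * X < 0 by rewrite pmulr_llt0.
lra.
Qed.

Lemma poly_eventually_neq0 (p : {poly F}) :
  p != 0 -> eventually (fun t => p.[t%:R] != 0).
Proof.
move/poly_eventually_sign; apply: eventually_imp => t.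
by apply: contraTneq => ->; rewrite mulr0 ltxx.
Qed.

Lemma poly_eventually_total (p q : {poly F}) :
  eventually (fun t => p.[t%:R] <= q.[t%:R]) \/
  eventually (fun t => q.[t%:R] <= p.[t%:R]).
Proof.
have [->|] := eqVneq p q; first by left; exists 0%N.
rewrite -subr_eq0 => /[dup] hpq /poly_eventually_sign hs.
have [l0|l0] := leP (lead_coef (p - q)) 0; [left|right];
  apply: eventually_imp hs => t; rewrite hornerD hornerN; nra.
Qed.

Lemma poly_eventually_min (I : finType) (P : pred I) (q : I -> {poly F})
    (i0 : I) : P i0 ->
  exists2 i, P i & eventually (fun t => forall j, P j ->
    (q i).[t%:R] <= (q j).[t%:R]).
Proof.
move=> Pi0.
suff [i Pi hi] : exists2 i, P i & forall j, j \in enum I -> P j ->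
    eventually (fun t => (q i).[t%:R] <= (q j).[t%:R]).
  exists i => //; apply: eventually_forall => j.
  case: (boolP (P j)) => Pj; last by exists 0%N.
  by have := hi j (mem_enum _ _) Pj; apply: eventually_imp.
elim: (enum I) => [|j s [i Pi hi]]; first by exists i0.
case: (boolP (P j)) => Pj; last first.
  exists i => // k; rewrite inE => /orP[/eqP->|]; last exact: hi.
  by rewrite (negPf Pj).
have [hij|hji] := poly_eventually_total (q i) (q j).
  by exists i => // k; rewrite inE => /orP[/eqP-> _ //|]; apply: hi.
exists j => // k; rewrite inE => /orP[/eqP-> _|ks Pk]; first by exists 0%N.
have := eventually_and hji (hi k ks Pk); apply: eventually_imp => t [].
exact: le_trans.
Qed.

End PolyInfinity.

(** * Quasi-polynomial choices *)

(** [P] records the residue classes to which [t] has been confined so far. Only the values of [g]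
    below [N] matter; a domain [nat] keeps its type independent of [N]. *)
Definition quasi (V : Type) (Q : nat -> V -> Prop) (P : nat -> Prop) : Prop :=
  exists N : nat, (0 < N)%N /\ exists g : nat -> V,
    eventually (fun t => P t -> Q t (g (t %% N)%N)).

Lemma quasi_split (V : Type) (Q : nat -> V -> Prop) (P : nat -> Prop) (N : nat) :
  (0 < N)%N -> (forall i, (i < N)%N -> quasi Q (fun t => P t /\ (t %% N)%N = i)) ->
  quasi Q P.
Proof.
case: N => // N _ h.
have /fin_all_exists[M hM] : forall i : 'I_N.+1, exists M : nat, (0 < M)%N /\
    exists g : nat -> V, eventually (fun t => P t /\ (t %% N.+1)%N = i ->
      Q t (g (t %% M)%N)) by move=> i; apply: h.
have /fin_all_exists[g hg] (i : 'I_N.+1) : exists g : nat -> V,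
    eventually (fun t => P t /\ (t %% N.+1)%N = i -> Q t (g (t %% M i)%N)).
  by have [_] := hM i.
have M0 i : (0 < M i)%N by have [] := hM i.
(* The residue of [t] modulo this product determines its class modulo [N.+1] and then its residue
   modulo the period belonging to that class. *)
exists (N.+1 * \prod_i M i)%N; split; first by rewrite muln_gt0 /= prodn_gt0.
exists (fun j => g (inord (j %% N.+1)) (j %% M (inord (j %% N.+1)))%N).
apply: eventually_imp (eventually_forall hg) => t ht Pt.
have hi : (t %% N.+1)%N = (inord (t %% N.+1) : 'I_N.+1).
  by rewrite inordK // ltn_pmod.
rewrite (modn_dvdm _ (dvdn_mulr _ (dvdnn _))) modn_dvdm; first exact: ht.
by rewrite dvdn_mull // (bigD1 (inord (t %% N.+1))) //= dvdn_mulr.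
Qed.

(** * Integer spans of the rows of a polynomial matrix *)

Section RowOperations.
Variables (F : archiRealFieldType) (n m : nat).
Implicit Types (b : 'M[{poly F}]_(n, m)) (s : 'rV[{poly F}]_n).

Definition mx_at (p q : nat) (b : 'M[{poly F}]_(p, q)) (t : nat) :
    'M[F]_(p, q) :=
  map_mx (horner_eval t%:R) b.

Definition zspan (B : 'M[F]_(n, m)) (v : 'rV[F]_m) : Prop :=
  exists x : 'rV[int]_n, v = map_mx intr x *m B.

(** The multipliers [s] are polynomials over [F]: integrality is asked only of their values at the
    [t] under consideration. *)
Definition rowop (j : 'I_n) s b : 'M[{poly F}]_(n, m) :=
  b + delta_mx j 0 *m (s *m b).

Lemma rowopE (j : 'I_n) s b i k :
  rowop j s b i k = b i k + (i == j)%:R * \sum_l s 0 l * b l k.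
Proof. by rewrite !mxE big_ord1 !mxE andbT. Qed.

(** As [s] does not involve row [j], the combination that is added is the same before and after the
    operation. *)
Lemma rowopK (j : 'I_n) s b :
  s 0 j = 0 -> rowop j (- s) (rowop j s b) = b.
Proof.
move=> sj; have se : s *m (delta_mx j 0 : 'cV_n) = 0.
  by rewrite -colE; apply/matrixP => a c; rewrite !mxE !ord1.
rewrite /rowop mulmxDr !mulNmx (mulmxA s (delta_mx _ _)) se mul0mx oppr0 addr0.
by rewrite mulmxN addrK.
Qed.

(** Coefficients [x] on the new rows amount to [x + x_j r] on the old ones. *)
Lemma zspan_rowop_sub (j : 'I_n) s b t v :
  (exists r : 'rV[int]_n, mx_at s t = map_mx intr r) ->
  zspan (mx_at (rowop j s b) t) v -> zspan (mx_at b t) v.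
Proof.
move=> [r hr] [x ->]; exists (x + x 0 j *: r).
rewrite /mx_at /rowop map_mxD !map_mxM /= -/(mx_at s t) -/(mx_at b t) hr.
rewrite mulmxDr map_mxD mulmxDl /= !mulmxA; congr (_ + _ *m _).
rewrite map_delta_mx -colE; apply/matrixP => a c; rewrite !mxE big_ord1 !mxE.
by rewrite (ord1 a) rmorphM.
Qed.

Lemma zspan_rowop (j : 'I_n) s b t v :
  s 0 j = 0 -> (exists r : 'rV[int]_n, mx_at s t = map_mx intr r) ->
  zspan (mx_at (rowop j s b) t) v <-> zspan (mx_at b t) v.
Proof.
move=> sj hs; split; first exact: zspan_rowop_sub.
rewrite -{1}[b](rowopK (j := j) b sj); apply: zspan_rowop_sub.
have [r hr] := hs; exists (- r).
by rewrite map_mxN /= -hr /mx_at map_mxN.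
Qed.

End RowOperations.

(** * Leading coefficients *)

Section Leading.
Variables (F : archiRealFieldType) (n m : nat).
Implicit Types b : 'M[{poly F}]_(n, m).

(* One more than the degree of row [i], and [0] for a zero row. *)
Definition rdeg b (i : 'I_n) : nat :=
  \max_k size (b i k).

Definition leadmx b : 'M[F]_(n, m) :=
  \matrix_(i, k) (b i k)`_(rdeg b i).-1.

(* The leading rows of the nonzero rows are linearly independent: each of them
   has a dual vector, killed by all the other leading rows. *)
Definition reduced b : bool :=
  [forall i, (0 < rdeg b i)%N ==> ((delta_mx 0 i : 'rV_n) <= (leadmx b)^T)%MS].

Lemma size_rdeg b i k : (size (b i k) <= rdeg b i)%N.
Proof. exact: (leq_bigmax (F := fun k => size (b i k))). Qed.

Lemma rdeg0 b i k : rdeg b i = 0%N -> b i k = 0.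
Proof.
by move=> h; have := size_rdeg b i k; rewrite h leqn0 size_poly_eq0 => /eqP.
Qed.

Lemma rdeg_leP b i d : reflect (forall k, (size (b i k) <= d)%N) (rdeg b i <= d)%N.
Proof.
by apply: (iffP (bigmax_leqP _ _ _)) => h k; [apply: h | move=> _; apply: h].
Qed.

Lemma coef_rdeg b i k d : (rdeg b i <= d)%N -> (b i k)`_d = 0.
Proof. by move=> h; rewrite nth_default // (leq_trans (size_rdeg b i k)). Qed.

Lemma reduced_dual b : reduced b -> exists y : 'I_n -> 'cV[F]_m,
  forall i, (0 < rdeg b i)%N -> leadmx b *m y i = delta_mx i 0.
Proof.
move=> /forallP hb.
have H i : exists y : 'cV[F]_m, (0 < rdeg b i)%N -> leadmx b *m y = delta_mx i 0.
  case: (posnP (rdeg b i)) => di; first by exists 0.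
  have /submxP[D hD] := implyP (hb i) di; exists D^T => _.
  by rewrite -[leadmx b]trmxK -trmx_mul -hD trmx_delta.
exact: fin_all_exists H.
Qed.

(** Pairing the combination with the dual vector [y i] isolates [x_i] times its top power of [t], up
    to an error of [e] times the whole left-hand sum [S]. *)
Lemma reduced_lower_bound b : reduced b -> exists2 C : F, 0 <= C &
  eventually (fun t => forall x : 'rV[F]_n,
    \sum_(i | (0 < rdeg b i)%N) `|x 0 i| * t%:R ^+ (rdeg b i).-1
      <= C * \sum_k `|(x *m mx_at b t) 0 k|).
Proof.
move=> /reduced_dual[y hy]; pose Y : F := \sum_i \sum_k `|y i k 0|.
have Y0 : 0 <= Y by do 2![apply: sumr_ge0 => ? _].
exists (2 * Y); first by rewrite mulr_ge0.
pose p i j : {poly F} := \sum_k y i k 0 *: b j k.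
(* Chosen so that the [n] errors together take at most half of [S]; [n.+1] keeps the denominator
   nonzero when [n = 0]. *)
pose e : F := (2 * n.+1%:R)^-1.
have e0 : 0 < e by rewrite invr_gt0 mulr_gt0 // ltr0n.
have sp i j : (size (p i j) <= (rdeg b j).-1.+1)%N.
  apply: leq_trans (leqSpred _).
  apply: leq_trans (size_sum _ _ _) _; apply/bigmax_leqP => k _.
  by apply: leq_trans (size_scale_leq _ _) (size_rdeg _ _ _).
have cp i j : (0 < rdeg b i)%N -> (p i j)`_(rdeg b j).-1 = (j == i)%:R.
  move=> /hy/matrixP/(_ j 0); rewrite !mxE andbT => <-.
  by rewrite coef_sum; apply: eq_bigr => k _; rewrite coefZ mxE mulrC.
have := eventually_forall (fun i =>
  eventually_forall (fun j => poly_top_asymp (sp i j) e0)).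
apply: eventually_imp => t ht x.
set w := x *m _; set S := \sum_(i | _) _.
pose W i := (w *m y i) 0 0.
have t0 d : 0 <= t%:R ^+ d :> F by rewrite exprn_ge0 ?ler0n.
have S0 : 0 <= S by apply: sumr_ge0 => i _; rewrite mulr_ge0.
have Wx i : W i = \sum_(j | (0 < rdeg b j)%N) x 0 j * (p i j).[t%:R].
  rewrite /W /w -mulmxA mxE [RHS]big_mkcond; apply: eq_bigr => j _.
  have -> : (mx_at b t *m y i) j 0 = (p i j).[t%:R].
    rewrite mxE horner_sum; apply: eq_bigr => k _.
    by rewrite !mxE hornerZ mulrC.
  case: posnP => // dj; rewrite (_ : p i j = 0) ?horner0 ?mulr0 //.
  by apply: big1 => k _; rewrite rdeg0 // scaler0.
have hi i : (0 < rdeg b i)%N ->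
    `|x 0 i| * t%:R ^+ (rdeg b i).-1 <= `|W i| + e * S.
  move=> di.
  have -> : `|x 0 i| * t%:R ^+ (rdeg b i).-1 = `|x 0 i * t%:R ^+ (rdeg b i).-1|.
    by rewrite normrM (ger0_norm (t0 _)).
  have -> : x 0 i * t%:R ^+ (rdeg b i).-1 = W i - \sum_(j | (0 < rdeg b j)%N)
      x 0 j * ((p i j).[t%:R] - (p i j)`_(rdeg b j).-1 * t%:R ^+ (rdeg b j).-1).
    rewrite Wx -sumrB (bigD1 i) //= big1 ?addr0; first
      by rewrite (cp i i di) eqxx mul1r mulrBr opprB addrC subrK.
    by move=> j /andP[_ /negPf ji]; rewrite (cp i j di) ji mul0r subr0 subrr.
  apply: le_trans (ler_normB _ _) _; rewrite lerD2l.
  apply: le_trans (ler_norm_sum _ _ _) _; rewrite mulr_sumr; apply: ler_sum => j _.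
  by rewrite normrM mulrCA ler_wpM2l.
have SW : S <= \sum_i `|W i| + e * n%:R * S.
  apply: (@le_trans _ _ (\sum_i (`|W i| + e * S))).
    rewrite [leLHS]big_mkcond; apply: ler_sum => i _; case: ifP => [/hi //|_].
    by rewrite addr_ge0 // mulr_ge0 // ltW.
  rewrite big_split /= lerD2l sumr_const card_ord.
  by rewrite mulr_natr mulrnAl lexx.
have en : e * n%:R <= 1 / 2.
  rewrite /e ler_pdivrMl ?mulr_gt0 ?ltr0n // -(natr1 n).
  have : 0 <= n%:R :> F by rewrite ler0n.
  lra.
have S2 : S <= 2 * \sum_i `|W i| by nra.
apply: le_trans S2 _; rewrite -mulrA ler_wpM2l // /Y mulr_suml.
apply: ler_sum => i _; rewrite /W mxE; apply: le_trans (ler_norm_sum _ _ _) _.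
rewrite mulr_suml; apply: ler_sum => k _; rewrite normrM mulrC ler_wpM2l //.
by rewrite (bigD1 k) //= lerDl sumr_ge0.
Qed.

Lemma row_upper_bound b i : exists2 C : F, 0 <= C &
  eventually (fun t => \sum_k `|mx_at b t i k| <= C * t%:R ^+ (rdeg b i).-1).
Proof.
(* The [1] absorbs the lower terms of each entry. *)
exists (\sum_k (`|(b i k)`_(rdeg b i).-1| + 1)).
  by apply: sumr_ge0 => k _; rewrite addr_ge0.
have H k : eventually (fun t => `|mx_at b t i k| <=
    (`|(b i k)`_(rdeg b i).-1| + 1) * t%:R ^+ (rdeg b i).-1).
  have sp : (size (b i k) <= (rdeg b i).-1.+1)%N.
    exact: leq_trans (size_rdeg b i k) (leqSpred _).
  have := poly_top_asymp sp ltr01; apply: eventually_imp => t.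
  have t0 : 0 <= t%:R ^+ (rdeg b i).-1 :> F by rewrite exprn_ge0 ?ler0n.
  rewrite !mxE /horner_eval => h.
  rewrite -[X in `|X|](subrK ((b i k)`_(rdeg b i).-1 * t%:R ^+ (rdeg b i).-1)).
  apply: le_trans (ler_normD _ _) _.
  by rewrite normrM (ger0_norm t0) mulrDl addrC lerD2l.
apply: eventually_imp (eventually_forall H) => t h.
by rewrite mulr_suml; apply: ler_sum.
Qed.

End Leading.

(** A unit row outside the row space of the transposed leading matrix is detected by some column of
    the cokernel. That column is a relation between the leading rows with a nonzero coefficient at
    [i]; clearing denominators makes it integral. *)
Lemma not_reduced_relation (n m : nat) (b : 'M[{poly rat}]_(n, m)) : ~~ reduced b ->
  exists c : 'rV[int]_n, map_mx intr c *m leadmx b = 0 /\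
    exists i, c 0 i != 0 /\ (0 < rdeg b i)%N.
Proof.
rewrite negb_forall => /existsP[i]; rewrite negb_imply => /andP[di].
rewrite submxE; set C := cokermx _ => /eqP hC.
have [r hr] : exists r, C i r != 0.
  apply/existsP; rewrite -negb_forall; apply/negP => /forallP h; apply: hC.
  rewrite -rowE; apply/matrixP => a k; rewrite [LHS]mxE [RHS]mxE; exact/eqP/h.
pose c := (col r C)^T.
have hc : c *m leadmx b = 0.
  rewrite -[LHS]trmxK trmx_mul trmxK colE mulmxA mulmx_coker.
  by rewrite mul0mx trmx0.
pose D : int := \prod_j denq (c 0 j).
have hD j : exists z : int, z%:~R = D%:~R * c 0 j :> rat.
  exists (\prod_(l | l != j) denq (c 0 l) * numq (c 0 j)).
  rewrite /D [X in _ = X%:~R * _](bigD1 j) //= !rmorphM /= numqE; ring.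
have [z hz] := fin_all_exists hD.
exists (\row_j z j); split; last first.
  exists i; split=> //; rewrite mxE -(intr_eq0 rat) hz mulf_neq0 //;
    last by rewrite mxE mxE.
  by rewrite intr_eq0; apply/prodf_neq0 => j _; rewrite denq_neq0.
rewrite (_ : map_mx _ _ = D%:~R *: c); first by rewrite -scalemxAl hc scaler0.
by apply/matrixP => a j; rewrite !mxE hz !mxE.
Qed.

(** * Shortest vectors when the leading rows are independent *)

Definition sqnorm (F : archiRealFieldType) (m : nat) (v : 'rV[F]_m) : F :=
  \sum_k v 0 k ^+ 2.

(** Squared norms stay in [F], and for a polynomial vector they are polynomial in [t]. *)
Definition shortest_in (F : archiRealFieldType) (m : nat)
    (L : 'rV[F]_m -> Prop) (v : 'rV[F]_m) : Prop :=
  [/\ L v, v != 0 & forall w, L w -> w != 0 -> sqnorm v <= sqnorm w].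

Section Shortest.
Variables (F : archiRealFieldType) (n m : nat).
Implicit Types b : 'M[{poly F}]_(n, m).

Lemma sqnorm_le_norm1 (v : 'rV[F]_m) : sqnorm v <= (\sum_k `|v 0 k|) ^+ 2.
Proof.
rewrite expr2 mulr_suml; apply: ler_sum => k _.
rewrite -real_normK ?num_real // expr2 ler_wpM2l //.
by rewrite (bigD1 k) //= lerDl sumr_ge0.
Qed.

Lemma norm_entry_le (v : 'rV[F]_m) (a : F) k :
  0 <= a -> sqnorm v <= a ^+ 2 -> `|v 0 k| <= a.
Proof.
move=> a0 h; rewrite -ler_sqr ?nnegrE // real_normK ?num_real //.
apply: le_trans h; rewrite /sqnorm (bigD1 k) //= lerDl.
by apply: sumr_ge0 => l _; apply: sqr_ge0.
Qed.

Lemma mx_at_intmul b (x : 'rV[int]_n) t :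
  mx_at (map_mx intr x *m b) t = map_mx intr x *m mx_at b t.
Proof.
rewrite /mx_at map_mxM; congr (_ *m _).
by apply/matrixP => i j; rewrite !mxE rmorph_int.
Qed.

Lemma rdeg_gt0 b i : (0 < rdeg b i)%N -> exists k, b i k != 0.
Proof.
rewrite ltnNge => /negP h; apply/existsP; rewrite -negb_forall.
apply/negP => /forallP h0; apply: h; apply/rdeg_leP => k.
by rewrite leqn0 size_poly_eq0.
Qed.

(** The entries of such a short vector are at most the 1-norm of row [i0], of order [t^d0]. The
    lower bound then gives [|x_i| t^di' <= C m B t^d0], and [d0 <= di'] by minimality. *)
Lemma reduced_short_coords b i0 : reduced b -> (0 < rdeg b i0)%N ->
  (forall i, (0 < rdeg b i)%N -> (rdeg b i0 <= rdeg b i)%N) ->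
  exists K : nat, eventually (fun t => forall x : 'rV[int]_n,
    sqnorm (map_mx intr x *m mx_at b t) <= sqnorm (row i0 (mx_at b t)) ->
    forall i, (0 < rdeg b i)%N -> (`|x 0%R i| <= K)%N).
Proof.
move=> /reduced_lower_bound[C C0 hC] di0 hmin.
have [B B0 hB] := row_upper_bound b i0.
have CB0 : 0 <= C * (m%:R * B) by rewrite mulr_ge0 // mulr_ge0 // ler0n.
exists (Num.bound (C * (m%:R * B))).
have := eventually_and (eventually_nat 1) (eventually_and hC hB).
apply: eventually_imp => t [t1 [{}hC {}hB]] x hx i di.
have t1' : 1 <= t%:R :> F by rewrite (ler_nat _ 1).
set d0 := (rdeg b i0).-1 in hB; set di' := (rdeg b i).-1.
have hd : (d0 <= di')%N by have := hmin i di; rewrite /d0 /di'; lia.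
set beta := \sum_k _ in hB.
have beta0 : 0 <= beta by apply: sumr_ge0.
set w := _ *m _ in hx.
have hw k : `|w 0 k| <= beta.
  apply: norm_entry_le => //; apply: le_trans hx _.
  apply: le_trans (sqnorm_le_norm1 _) _.
  by rewrite (_ : \sum_k _ = beta) //; apply: eq_bigr => l _; rewrite mxE.
have sw : \sum_k `|w 0 k| <= m%:R * beta.
  rewrite mulr_natl -[X in _ *+ X]card_ord -sumr_const; exact: ler_sum.
have hxi : `|(x 0 i)%:~R| * t%:R ^+ di' <= C * (m%:R * B) * t%:R ^+ di'.
  have := hC (map_mx intr x); rewrite (bigD1 i) //= mxE => hS.
  apply: (@le_trans _ _ (C * (m%:R * (B * t%:R ^+ di')))); last by rewrite !mulrA.
  apply: le_trans (le_trans hS _); last first.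
    apply: ler_wpM2l => //; apply: le_trans sw _; apply: ler_wpM2l;
      first exact: ler0n.
    apply: le_trans hB _; apply: ler_wpM2l => //; exact: ler_weXn2l.
  rewrite lerDl; apply: sumr_ge0 => l _; rewrite mulr_ge0 // exprn_ge0 // ler0n.
have tp : 0 < t%:R ^+ di' :> F by rewrite exprn_gt0 // ltr0n.
rewrite ler_pM2r // -intr_norm in hxi.
have := le_lt_trans hxi (archi_boundP CB0).
rewrite -[X in _ < X]/(Posz _)%:~R ltr_int; lia.
Qed.

Lemma reduced_candidates b i0 : reduced b -> (0 < rdeg b i0)%N ->
  (forall i, (0 < rdeg b i)%N -> (rdeg b i0 <= rdeg b i)%N) ->
  exists (I : finType) (X : I -> 'rV[int]_n), eventually (fun t =>
    forall x : 'rV[int]_n,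
    sqnorm (map_mx intr x *m mx_at b t) <= sqnorm (row i0 (mx_at b t)) ->
    exists z, map_mx intr (X z) *m mx_at b t = map_mx intr x *m mx_at b t).
Proof.
move=> hb di0 hmin; have [K hK] := reduced_short_coords hb di0 hmin.
exists {ffun 'I_n -> 'I_(K.*2).+1},
  (fun z : {ffun 'I_n -> 'I_(K.*2).+1} => \row_i ((z i : nat)%:Z - K%:Z)).
apply: eventually_imp hK => t hK x /hK{}hK.
(* Coefficients are stored shifted by [K]. Those of zero rows do not affect the vector and are set
   to [0], stored as [K]. *)
exists [ffun i => if (0 < rdeg b i)%N then inord `|(x 0 i + K%:Z)%R| else inord K].
apply/matrixP => a k; rewrite !mxE; apply: eq_bigr => i _.
case: (posnP (rdeg b i)) => di.
  by rewrite [mx_at b t i k]mxE rdeg0 // /horner_eval horner0 !mulr0.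
congr (_ * _); rewrite !mxE ffunE di (ord1 a); congr (_%:~R).
have := hK i di => hi; rewrite inordK; lia.
Qed.

Lemma reduced_shortest b : reduced b -> exists g : 'rV[{poly F}]_m,
  eventually (fun t => mx_at b t != 0 ->
    shortest_in (zspan (mx_at b t)) (mx_at g t)).
Proof.
move=> hb; case: (pickP (fun i => 0 < rdeg b i)%N) => [i1 di1 | b0]; last first.
  (* Without nonzero rows the matrix vanishes at every [t], and the claim is vacuous. *)
  exists 0; exists 0%N => t _ /eqP[]; apply/matrixP => i k.
  rewrite !mxE rdeg0 ?/horner_eval ?horner0 //.
  by apply/eqP; have := b0 i; rewrite lt0n => /negbFE.
have [i0 di0 hmin] : exists2 i0, (0 < rdeg b i0)%N &
    forall i, (0 < rdeg b i)%N -> (rdeg b i0 <= rdeg b i)%N.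
  by case: (@arg_minnP _ i1 (fun i => 0 < rdeg b i)%N (rdeg b) di1) => i0; exists i0.
have [I [X hX]] := reduced_candidates hb di0 hmin.
pose V z : 'rV[{poly F}]_m := map_mx intr (X z) *m b.
pose q z := \sum_k V z 0 k ^+ 2.
have Vq z t : sqnorm (mx_at (V z) t) = (q z).[t%:R].
  by rewrite horner_sum; apply: eq_bigr => k _; rewrite mxE horner_exp.
have Vneq0 z t : mx_at (V z) t != 0 -> V z != 0.
  apply: contraNneq => ->; apply/eqP/matrixP => i k.
  by rewrite !mxE /horner_eval horner0.
have [k0 hk0] := rdeg_gt0 di0.
have i0E t : row i0 (mx_at b t) =
    map_mx intr (delta_mx 0 i0 : 'rV[int]_n) *m mx_at b t.
  by rewrite map_delta_mx rowE.
have hbt : eventually (fun t => row i0 (mx_at b t) != 0).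
  apply: eventually_imp (poly_eventually_neq0 hk0) => t.
  by apply: contraNneq => /matrixP/(_ 0 k0); rewrite !mxE /horner_eval => ->.
(* At a single large [T], row [i0] is nonzero and is the value of a candidate. *)
have [z0 hz0] : exists z, V z != 0.
  have [T hT] := eventually_and hX hbt; have [{}hX hbT] := hT T (leqnn T).
  have [z hz] : exists z, map_mx intr (X z) *m mx_at b T = row i0 (mx_at b T).
    by rewrite i0E; apply: hX; rewrite -i0E.
  by exists z; apply: (@Vneq0 _ T); rewrite mx_at_intmul hz.
have [z1 hz1 hmin1] := @poly_eventually_min F I (fun z => V z != 0) q z0 hz0.
have [k1 hk1] : exists k, V z1 0 k != 0.
  apply/existsP; rewrite -negb_forall; apply: contra hz1 => /forallP h.
  by apply/eqP/matrixP => i k; rewrite (ord1 i) (eqP (h k)) mxE.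
exists (V z1).
have := eventually_and (eventually_and hX hbt)
  (eventually_and hmin1 (poly_eventually_neq0 hk1)).
apply: eventually_imp => t [[{}hX {}hbt] [{}hmin1 {}hk1]] _; split.
- by exists (X z1); rewrite mx_at_intmul.
- by apply: contraNneq hk1 => /matrixP/(_ 0 k1); rewrite !mxE /horner_eval => ->.
have key (x : 'rV[int]_n) : map_mx intr x *m mx_at b t != 0 ->
    sqnorm (map_mx intr x *m mx_at b t) <= sqnorm (row i0 (mx_at b t)) ->
    sqnorm (mx_at (V z1) t) <= sqnorm (map_mx intr x *m mx_at b t).
  move=> x0 /hX[z hz]; rewrite -hz -mx_at_intmul !Vq; apply: hmin1.
  by apply: (@Vneq0 _ t); rewrite mx_at_intmul hz.
move=> _ [x ->] w0.
(* A vector longer than row [i0] is handled by applying the bound to that row instead. *)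
have [|/ltW] := leP (sqnorm (map_mx intr x *m mx_at b t))
  (sqnorm (row i0 (mx_at b t))).
  exact: key.
by apply: le_trans; rewrite i0E; apply: key; rewrite -i0E.
Qed.

End Shortest.

(** * Lowering the degrees of the generators *)

Section Reduction.
Variables (F : archiRealFieldType) (n m : nat).
Implicit Types b : 'M[{poly F}]_(n, m).

(** Since [rdeg] exceeds the degree by one, the sum also drops when a constant row becomes zero. *)
Definition degsum b : nat := \sum_i rdeg b i.

Lemma rowop_neq b j s i k : i != j -> rowop j s b i k = b i k.
Proof. by rewrite rowopE => /negPf ->; rewrite mul0r addr0. Qed.

Lemma rdeg_rowop_neq b j s i : i != j -> rdeg (rowop j s b) i = rdeg b i.
Proof. by move=> ij; apply: eq_bigr => k _; rewrite rowop_neq. Qed.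

Lemma degsum_rowop_lt b j s :
  (rdeg (rowop j s b) j < rdeg b j)%N -> (degsum (rowop j s b) < degsum b)%N.
Proof.
move=> h; rewrite /degsum (bigD1 j) //= [ltnRHS](bigD1 j) //=.
by under eq_bigr => i ij do rewrite rdeg_rowop_neq //; rewrite ltn_add2r.
Qed.

(** Replacing [X^(e+1)] by [(X - a) X^e] leaves the top coefficient unchanged, so the correction by
    [a] does not spoil the cancellation of leading rows. *)
Lemma coef_shift_top (p : {poly F}) (a : F) d e l :
  (size p <= d.+1)%N -> (d + e < l)%N ->
  (('X - a%:P) * 'X^e * p)`_l = (l == (d + e).+1)%:R * p`_d.
Proof.
move=> sp hl; rewrite mulrAC coefMXn ltnNge (leq_trans (leq_addl d e)) ?(ltnW hl) //=.
rewrite mulrBl coefB coefXM coefCM.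
have -> : (l - e == 0)%N = false by lia.
rewrite [p`_(l - e)]nth_default ?(leq_trans sp) //; last by lia.
rewrite mulr0 subr0; case: eqP => [->|hne]; first by rewrite mul1r; congr (_`_ _); lia.
by rewrite mul0r nth_default // (leq_trans sp) //; lia.
Qed.

(* The factor [t - r] makes the rational multiplier [c j / c i] integral on
   the class of [r] modulo [c i]. *)
Definition top_multiplier b (c : 'rV[int]_n) (i : 'I_n) (r : nat) :
    'rV[{poly F}]_n :=
  \row_j (if j == i then 0 else
    ((c 0 j)%:~R / (c 0 i)%:~R) *:
      (('X - r%:R%:P) * 'X^((rdeg b i - rdeg b j).-1))).

Lemma top_multiplier_int b (c : 'rV[int]_n) i r t : c 0 i != 0 ->
  (t %% `|c 0%R i|)%N = r ->
  exists z : 'rV[int]_n, mx_at (top_multiplier b c i r) t = map_mx intr z.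
Proof.
move=> ci htr; pose u : nat := (t %/ `|c 0%R i|)%N.
(* The sign appears because the division is by the absolute value of [c_i]. *)
have htu : t%:R - r%:R = (Num.sg (c 0 i) * u%:Z)%:~R * (c 0 i)%:~R :> F.
  rewrite -intrM mulrAC -normrEsg -[t%:R]/(t%:Z%:~R) -[r%:R]/(r%:Z%:~R) -intrB.
  congr (_%:~R); rewrite -abszE {1}(divn_eq t `|c 0%R i|) htr -/u; lia.
exists (\row_j (if j == i then 0 else
  c 0 j * (Num.sg (c 0 i) * u%:Z) * t%:Z ^+ (rdeg b i - rdeg b j).-1)).
apply/matrixP => a j; rewrite !mxE /horner_eval; case: (j == i).
  by rewrite horner0.
rewrite hornerZ !hornerE htu.
have ci' : (c 0 i)%:~R != 0 :> F by rewrite intr_eq0.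
rewrite 2!rmorphM rmorphXn /= -[t%:Z%:~R]/(t%:R) !mulrA; congr (_ * _).
by rewrite !rmorphM /= mulrAC (mulrAC _ _ (c 0 i)%:~R) divfK.
Qed.

(** Divided by [c_i], the relation expresses leading row [i] as minus a combination of the others.
    The multipliers raise those rows to the degree of row [i], whose top coefficients then
    cancel. *)
Lemma top_reduce b (c : 'rV[int]_n) i r :
  map_mx intr c *m leadmx b = 0 -> c 0 i != 0 -> (0 < rdeg b i)%N ->
  (forall j, j != i -> c 0 j != 0 -> (rdeg b j < rdeg b i)%N) ->
  (degsum (rowop i (top_multiplier b c i r) b) < degsum b)%N.
Proof.
move=> hc ci di hlt; apply: degsum_rowop_lt.
have ci' : (c 0 i)%:~R != 0 :> F by rewrite intr_eq0.
suff : (rdeg (rowop i (top_multiplier b c i r) b) i <= (rdeg b i).-1)%N.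
  by rewrite -ltnS prednK.
apply/rdeg_leP => k; apply/leq_sizeP => l hl.
rewrite rowopE eqxx mul1r coefD coef_sum.
have hj j : j != i -> (top_multiplier b c i r 0 j * b j k)`_l =
    (l == (rdeg b i).-1)%:R * ((c 0 j)%:~R / (c 0 i)%:~R * leadmx b j k).
  move=> ji; rewrite mxE (negPf ji) -scalerAl coefZ.
  have [->|cj] := eqVneq (c 0 j) 0; first by rewrite mulr0z !mul0r mulr0.
  rewrite mulrCA; congr (_ * _); have dj := hlt j ji cj.
  (* For a zero row the truncated predecessor would put the top exponent one too high, but both
     sides vanish. *)
  case: (posnP (rdeg b j)) => dj0; first by rewrite mxE rdeg0 // mulr0 !coef0 mulr0.
  rewrite (@coef_shift_top _ _ (rdeg b j).-1) ?mxE.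
  - by congr ((l == _)%:R * _); lia.
  - by rewrite prednK // size_rdeg.
  - by lia.
have hi : (b i k)`_l = (l == (rdeg b i).-1)%:R * leadmx b i k.
  rewrite mxE; case: eqP => [->|hne]; first by rewrite mul1r.
  by rewrite mul0r coef_rdeg //; lia.
rewrite hi (bigD1 i) //= [top_multiplier b c i r 0 i]mxE eqxx mul0r coef0 add0r.
rewrite (eq_bigr _ hj) -mulr_sumr -mulrDr.
suff -> : leadmx b i k +
    \sum_(j | j != i) (c 0 j)%:~R / (c 0 i)%:~R * leadmx b j k = 0.
  by rewrite mulr0.
apply: (mulfI ci'); rewrite mulr0 mulrDr mulr_sumr.
have h : \sum_j (c 0 j)%:~R * leadmx b j k = 0.
  move/matrixP: hc => /(_ 0 k); rewrite [LHS]mxE [RHS]mxE => h; apply: etrans h.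
  by apply: eq_bigr => j _; rewrite [map_mx _ _ _ _]mxE.
rewrite -[RHS]h [RHS](bigD1 i) //=; congr (_ + _); apply: eq_bigr => j _.
by rewrite mulrA [_ * (_ / _)]mulrC divfK.
Qed.

Definition relation_weight (c : 'rV[int]_n) : nat := \sum_j `|c 0%R j|.

(* One subtractive Euclid step on the coefficients of a relation between
   leading rows, performed on two generators of the same degree. *)
Lemma euclid_step b (c : 'rV[int]_n) i j :
  map_mx intr c *m leadmx b = 0 -> i != j -> c 0 j != 0 -> c 0 i != 0 ->
  (0 < rdeg b j)%N -> rdeg b i = rdeg b j -> (`|c 0%R j| <= `|c 0%R i|)%N ->
  exists b', (forall t v, zspan (mx_at b' t) v <-> zspan (mx_at b t) v) /\
    ((degsum b' < degsum b)%N \/ (degsum b' <= degsum b)%N /\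
     exists c' : 'rV[int]_n, map_mx intr c' *m leadmx b' = 0 /\
       (exists l, c' 0 l != 0 /\ (0 < rdeg b' l)%N) /\
       (relation_weight c' < relation_weight c)%N).
Proof.
move=> hc ij cj ci dj dij hcij.
(* With this sign, [c_i - sg c_j] has absolute value [|c_i| - |c_j|]. *)
pose sg : int := Num.sg (c 0 i) * Num.sg (c 0 j).
pose s : 'rV[{poly F}]_n := map_mx intr (sg *: delta_mx 0 i).
have hs t : mx_at s t = map_mx intr (sg *: delta_mx 0 i).
  apply/matrixP => a l; rewrite !mxE /horner_eval.
  by rewrite -[RHS](rmorph_int (horner_eval (t%:R : F))).
have bj k : rowop j s b j k = b j k + sg%:~R * b i k.
  rewrite rowopE eqxx mul1r; congr (_ + _); rewrite (bigD1 i) //= big1 ?addr0.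
    by rewrite !mxE !eqxx mulr1.
  by move=> l /negPf li; rewrite !mxE li andbF mulr0 mul0r.
have cbj k l : (rowop j s b j k)`_l = (b j k)`_l + sg%:~R * (b i k)`_l.
  by rewrite bj coefD -(rmorph_int polyC) coefCM.
have dle : (rdeg (rowop j s b) j <= rdeg b j)%N.
  apply/rdeg_leP => k; apply/leq_sizeP => l hl.
  by rewrite cbj !coef_rdeg ?dij // mulr0 addr0.
exists (rowop j s b); split.
  move=> t v; apply: zspan_rowop; last by exists (sg *: delta_mx 0 i).
  by rewrite !mxE eq_sym (negPf ij) andbF mulr0.
move: dle; rewrite leq_eqVlt => /orP[/eqP dE|/degsum_rowop_lt]; [right | by left].
have dEl l : rdeg (rowop j s b) l = rdeg b l.
  by have [->//|lj] := eqVneq l j; rewrite rdeg_rowop_neq.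
split; first by rewrite /degsum; under eq_bigr => l _ do rewrite dEl.
have hL : leadmx (rowop j s b) = leadmx b + sg%:~R *: (delta_mx j i *m leadmx b).
  apply/matrixP => l k; rewrite [LHS]mxE dEl [RHS]mxE [X in _ + X]mxE.
  have -> : (delta_mx j i *m leadmx b) l k = (l == j)%:R * leadmx b i k.
    rewrite mxE (bigD1 i) //= big1 ?addr0 => [|a /negPf ai].
      by rewrite [delta_mx _ _ _ _]mxE eqxx andbT.
    by rewrite [delta_mx _ _ _ _]mxE ai andbF mul0r.
  rewrite [leadmx b l k]mxE [leadmx b i k]mxE; have [->|lj] := eqVneq l j.
    by rewrite cbj mul1r dij.
  by rewrite rowop_neq // mul0r mulr0 addr0.
(* Leading row [j] has gained [sg] times leading row [i]; lowering [c_i] by [sg c_j] compensates for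
   this. The coefficient at [j] is unchanged, hence still nonzero. *)
exists (c - (sg * c 0 j) *: delta_mx 0 i); split; last split.
- rewrite hL map_mxB map_mxZ map_delta_mx /= mulmxDr !mulmxBl hc sub0r.
  rewrite -scalemxAr (mulmxA (map_mx _ _)) -[in X in _ + X]scalemxAr mulmxA.
  have -> : map_mx intr c *m (delta_mx j i : 'M[F]_n) = (c 0 j)%:~R *: delta_mx 0 i.
    apply/matrixP => a l; rewrite !mxE (bigD1 j) //= big1 ?addr0.
      by rewrite !mxE (ord1 a) eqxx.
    by move=> u /negPf uj; rewrite !mxE uj mulr0.
  rewrite -!scalemxAl mul_delta_mx_0 // mul0mx !scaler0 subr0 scalerA rmorphM /=.
  by rewrite addNr.
- exists j; split; last by rewrite dE.
  by rewrite !mxE [j == i]eq_sym (negPf ij) andbF mulr0 subr0.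
- rewrite /relation_weight (bigD1 i) //= [ltnRHS](bigD1 i) //=.
  under eq_bigr => l /negPf li do rewrite !mxE li andbF mulr0 subr0.
  rewrite ltn_add2r !mxE !eqxx mulr1 /sg.
  move: (c 0 i) (c 0 j) ci cj hcij => x y.
  case: (sgrP x) => hx; case: (sgrP y) => hy //; rewrite ?mul1r ?mulN1r ?mulr1; lia.
Qed.

End Reduction.

(** Induction on the degree sum, and within it on the weight of a relation. [L] stays fixed while
    [b] and [P] vary, because a new matrix need span [L t] only on the current residue class. *)
Lemma parametric_shortest (n m : nat) (L : nat -> 'rV[rat]_m -> Prop)
    (b : 'M[{poly rat}]_(n, m)) (P : nat -> Prop) :
  (forall t, P t -> forall v, zspan (mx_at b t) v <-> L t v) ->
  quasi (fun t (g : 'rV[{poly rat}]_m) =>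
    (exists v, L t v /\ v != 0) -> shortest_in (L t) (mx_at g t)) P.
Proof.
have [D] := ubnP (degsum b); elim: D b P => // D IHD b P hD hP.
case: (boolP (reduced b)) => [hr|/not_reduced_relation[c [hc [i [ci di]]]]].
  have [g hg] := reduced_shortest hr; exists 1%N; split => //; exists (fun=> g).
  apply: eventually_imp hg => t hg Pt [v [Lv v0]].
  have [|h1 h2 h3] := hg.
    apply: contraNneq v0 => b0; have [x ->] := (hP t Pt v).2 Lv.
    by rewrite b0 mulmx0.
  split=> //; first by apply/(hP t Pt).
  by move=> w /(hP t Pt); apply: h3.
have [K] := ubnP (relation_weight c).
elim: K b c i hD hP hc ci di => // K IHK b c i1 hD hP hc ci1 di1 hK.
have [i ci hmax] : exists2 i, c 0 i != 0 &
    forall j, c 0 j != 0 -> (rdeg b j <= rdeg b i)%N.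
  by case: (@arg_maxnP _ i1 (fun i => c 0 i != 0) (rdeg b) ci1) => i; exists i.
have di : (0 < rdeg b i)%N := leq_trans di1 (hmax i1 ci1).
(* Either a second row of top degree occurs in the relation, and a Euclid step applies, or row [i]
   alone has top degree there and its leading row can be cancelled. *)
case: (pickP (fun j => [&& j != i, c 0 j != 0 & rdeg b j == rdeg b i])) => [j|hlt].
  move=> /and3P[ji cj /eqP dji].
  have [b' [hb' hdec]] : exists b' : 'M[{poly rat}]_(n, m),
      (forall t v, zspan (mx_at b' t) v <-> zspan (mx_at b t) v) /\
      ((degsum b' < degsum b)%N \/ (degsum b' <= degsum b)%N /\
       exists c' : 'rV[int]_n, map_mx intr c' *m leadmx b' = 0 /\
         (exists l, c' 0 l != 0 /\ (0 < rdeg b' l)%N) /\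
         (relation_weight c' < relation_weight c)%N).
    have [hij|hij] := leqP `|c 0%R j| `|c 0%R i|.
      by apply: (@euclid_step _ _ _ b c i j); rewrite // ?dji // eq_sym.
    by apply: (@euclid_step _ _ _ b c j i); rewrite // ltnW.
  have hP' t : P t -> forall v, zspan (mx_at b' t) v <-> L t v.
    by move=> Pt v; rewrite hb'; apply: hP.
  case: hdec => [hlt|[hle [c' [hc' [[l [cl dl]] hw]]]]].
    by apply: (IHD b') => //; apply: leq_trans hlt _.
  by apply: (IHK b' c' l) => //; [apply: leq_ltn_trans hle _ | apply: leq_trans hw _].
have hlt' j : j != i -> c 0 j != 0 -> (rdeg b j < rdeg b i)%N.
  move=> ji cj; rewrite ltn_neqAle hmax // andbT.
  by have := hlt j; rewrite ji cj /= => ->.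
(* On each class modulo [c_i] the cancelling multiplier has integral values. *)
apply: (@quasi_split _ _ _ `|c 0%R i|) => [|r hr]; first by rewrite absz_gt0.
apply: (IHD (rowop i (top_multiplier b c i r) b)).
  by apply: leq_trans (top_reduce r hc ci di hlt') _.
move=> t [Pt htr] v; rewrite zspan_rowop; first exact: hP.
- by rewrite mxE eqxx.
- exact: top_multiplier_int.
Qed.

(** * Integer lattices *)

Lemma map_mx_intr_inj (p q : nat) :
  injective (fun A : 'M[int]_(p, q) => map_mx intr A : 'M[rat]_(p, q)).
Proof.
move=> A B /matrixP h; apply/matrixP => i k; apply: (@intr_inj rat).
by have := h i k; rewrite !mxE.
Qed.

(** The coefficients are taken in the rationals because the degree reduction divides by coefficients
    of relations. *)
Definition generator_mx (m n : nat) (f : n.-tuple 'rV[{poly int}]_m) :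
    'M[{poly rat}]_(n, m) :=
  \matrix_(j, k) map_poly intr (tnth f j 0 k).

Lemma generator_mx_at (m n : nat) (f : n.-tuple 'rV[{poly int}]_m) t j k :
  mx_at (generator_mx f) t j k = (poly_vec_eval (tnth f j) t 0 k)%:~R.
Proof. by rewrite !mxE /horner_eval -(rmorph_nat intr) horner_map. Qed.

Lemma lattice_atE (m n : nat) (f : n.-tuple 'rV[{poly int}]_m) t (u : 'rV[int]_m) :
  lattice_at f t u <-> zspan (mx_at (generator_mx f) t) (map_mx intr u).
Proof.
have key (a : 'I_n -> int) :
    map_mx intr (\sum_(i < n) [tuple poly_vec_eval (tnth f j) t | j < n]`_i *~ a i)
    = map_mx intr (\row_i a i) *m mx_at (generator_mx f) t :> 'rV[rat]_m.
  apply/matrixP => o k; rewrite mxE summxE rmorph_sum mxE; apply: eq_bigr => i _.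
  rewrite generator_mx_at [map_mx _ _ _ _]mxE [X in X%:~R * _]mxE.
  rewrite -tnth_nth tnth_mktuple -scaler_int mxE rmorphM /= intz.
  by rewrite (ord1 o).
split=> [[a ->]|[x hx]]; first by exists (\row_i a i); rewrite key.
exists [ffun i => x 0 i]; apply: map_mx_intr_inj; rewrite hx key.
by congr (map_mx _ _ *m _); apply/matrixP => o i; rewrite mxE ffunE (ord1 o).
Qed.

Lemma zspan_generator_int (m n : nat) (f : n.-tuple 'rV[{poly int}]_m) t v :
  zspan (mx_at (generator_mx f) t) v -> exists u : 'rV[int]_m, v = map_mx intr u.
Proof.
move=> [x ->]; exists (x *m \matrix_(j, k) poly_vec_eval (tnth f j) t 0 k).
rewrite map_mxM /=; congr (_ *m _); apply/matrixP => j k.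
by rewrite generator_mx_at !mxE.
Qed.

(** Both squared norms come from the same integer sum of squares, through which the comparison
    passes from the rationals to [R]. *)
Lemma euclid_norm_le (R : realType) (m : nat) (u w : 'rV[int]_m) :
  sqnorm (map_mx intr u : 'rV[rat]_m) <= sqnorm (map_mx intr w) ->
  euclid_norm R u <= euclid_norm R w.
Proof.
have sqE (K : numDomainType) (x : 'rV[int]_m) :
    \sum_k (x 0 k)%:~R ^+ 2 = (\sum_k x 0 k ^+ 2)%:~R :> K.
  by rewrite rmorph_sum; apply: eq_bigr => k _; rewrite rmorphXn.
have sqnE (x : 'rV[int]_m) :
    sqnorm (map_mx intr x : 'rV[rat]_m) = (\sum_k x 0 k ^+ 2)%:~R.
  by rewrite -sqE; apply: eq_bigr => k _; rewrite mxE.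
by rewrite !sqnE ler_int => h; apply: ler_wsqrtr; rewrite !sqE ler_int.
Qed.

Theorem theorem1p2 (R : realType) (m n : nat)
    (f : n.-tuple 'rV[{poly int}]_m)
    (f_neq0 : exists j : 'I_n, tnth f j != 0) :
  exists N : nat, (0 < N)%N /\
  exists g : 'I_N -> 'rV[{poly rat}]_m,
  exists T : nat, forall t : nat, (T <= t)%N ->
  forall i : 'I_N, t = i %[mod N] ->
  exists2 u : 'rV[int]_m,
    poly_vec_eval (g i) t = map_mx intr u &
    shortest_nonzero R (lattice_at f t) u.
Proof.
pose L t := zspan (mx_at (generator_mx f) t).
have [N [N0 [g hg]]] := @parametric_shortest n m L (generator_mx f) (fun=> True)
  (fun t _ v => iff_refl _).
(* A nonzero polynomial entry of some generator has no large roots, so the lattice is eventually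
   nonzero. *)
have hL : eventually (fun t => exists v, L t v /\ v != 0).
  have [j fj] := f_neq0.
  have [k fjk] : exists k, tnth f j 0 k != 0.
    apply/existsP; rewrite -negb_forall; apply: contra fj => /forallP h.
    by apply/eqP/matrixP => o k; rewrite (ord1 o) (eqP (h k)) mxE.
  have hk : generator_mx f j k != 0.
    by rewrite mxE map_poly_eq0_id0 // intr_eq0 lead_coef_eq0.
  apply: eventually_imp (poly_eventually_neq0 hk) => t ht.
  exists (row j (mx_at (generator_mx f) t)); split.
    by exists (delta_mx 0 j); rewrite map_delta_mx rowE.
  by apply: contraNneq ht => /matrixP/(_ 0 k); rewrite !mxE /horner_eval => ->.
exists N; split=> //; exists (fun i => g i).
have [T hT] := eventually_and hg hL; exists T => t /hT[{}hg {}hL] i hi.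
have {hg}[Lg g0 gmin] := hg I hL.
rewrite hi modn_small ?ltn_ord // in Lg g0 gmin.
have [u hu] := zspan_generator_int Lg.
exists u; first by rewrite -hu; apply/matrixP => o k; rewrite !mxE (ord1 o).
rewrite hu in Lg g0 gmin; split.
- exact/lattice_atE.
- by apply: contraNneq g0 => ->; rewrite map_mx0.
move=> w /lattice_atE Lw w0; apply: euclid_norm_le; apply: gmin => //.
by apply: contraNneq w0 => h; apply/eqP/map_mx_intr_inj; rewrite h map_mx0.
Qed.
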